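(* Let $(\widetilde P_n^{(\lambda)})_n$ be the sequence of monic matrix polynomials defined by $\widetilde P_{-1}^{(\lambda)}=0$, $\widetilde P_0^{(\lambda)}=I$ and the recurrence relation $$x\widetilde P_n^{(\lambda)}(x)=\widetilde P_{n+1}^{(\lambda)}(x)+\Bigl(J+n+a+\lambda(I+A)^{-1}+aL_0^{-1}(I+A)^\lambda\mathcal D_n^{(\lambda)}A^*(\mathcal D_n^{(\lambda)})^{-1}(I+A)^{-\lambda}L_0\Bigr)\widetilde P_n^{(\lambda)}(x)$$ $$\qquad\qquad+L_0^{-1}(I+A)^\lambda\mathcal D_n^{(\lambda)}(\mathcal D_{n-1}^{(\lambda)})^{-1}(I+A)^{-\lambda}L_0\,\widetilde P_{n-1}^{(\lambda)}(x).$$ Then $(\widetilde P_n^{(\lambda)},\,P_n^{(\lambda)}(0)^{-1}(I+A)^n,\,\Upsilon^{(\lambda)}(x)^{-1},\,\mathfrak J^{(\lambda)}(x))$ is dual to $Q_x^{(\lambda)}$, and the following duality condition holds: $$Q_x^{(\lambda)}(\rho(n))=P_n^{(\lambda)}(0)^{-1}(I+A)^n\,\widetilde P_n^{(\lambda)}\bigl(\mathfrak J^{(\lambda)}(x)\bigr)\,\Upsilon^{(\lambda)}(x)^{-1},\qquad n,x\in\mathbb N_0.$$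
   Context: $N\ge1$, $a>0$, $\lambda\in\mathbb N_0=\{0,1,2,\dots\}$; scalars in matrix expressions mean multiples of $I$. $\mu_1,\dots,\mu_N>0$ satisfy $(\mu_j/\mu_k)^2=a^{k-j}\frac{(N-k)!}{(N-j)!}$ and $\delta_k^{(\lambda)}=(a/2)^\lambda\frac{(\lambda+k-1)!}{(k-1)!}$. $A$ is the $N\times N$ matrix whose only nonzero entries are $A_{k+1,k}=\mu_{k+1}/\mu_k=\sqrt{(N-k)/a}$, $1\le k\le N-1$; $J=\mathrm{diag}(1,\dots,N)$; $T^{(\lambda)}=\mathrm{diag}(\delta_1^{(\lambda)},\dots,\delta_N^{(\lambda)})$; $L_0$ is lower triangular with $(L_0)_{jk}=\frac{\mu_j}{\mu_k}\frac{(-a)^{j-k}}{(j-k)!}$ for $j\ge k$. $W^{(\lambda)}(x)=\frac{a^x}{x!}(I+A)^{x+\lambda}T^{(\lambda)}(I+A^* )^{x+\lambda}$, $x\in\mathbb N_0$; $P_n^{(\lambda)}$ are the monic matrix polynomials, $\deg P_n^{(\lambda)}=n$, orthogonal for $\langle P,Q\rangle^{(\lambda)}=\sum_{x=0}^\infty P(x)W^{(\lambda)}(x)Q(x)^*$; $\mathcal H_n^{(\lambda)}=\langle P_n^{(\lambda)},P_n^{(\lambda)}\rangle^{(\lambda)}$; $\mathcal D_n^{(\lambda)}$ is the positive definite diagonal matrix with $\mathcal H_n^{(\lambda)}=L_0^{-1}(I+A)^{n+\lambda}\mathcal D_n^{(\lambda)}(I+A^* )^{n+\lambda}(L_0^*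 )^{-1}$. The matrices $P_n^{(\lambda)}(0)$ are invertible. $\mathfrak J^{(\lambda)}(x)=J+(x+\lambda)(I+A)^{-1}$. $\Upsilon^{(\lambda)}(x)=a^{-x}(I+A)^{-x}$. $\rho(n)=P_n^{(\lambda)}(0)^{-1}\bigl(a(I+A)-J-(n+\lambda)(I+A)^{-1}\bigr)P_n^{(\lambda)}(0)$. $Q_x^{(\lambda)}$ is the unique monic matrix polynomial of degree $x$, evaluated with the variable on the left ($Q(\mathcal N)=\sum_k\mathcal N^kA_k$), with $Q_x^{(\lambda)}(\rho(n))=P_n^{(\lambda)}(0)^{-1}P_n^{(\lambda)}(x)\Upsilon^{(\lambda)}(x)^{-1}$ for all $n\in\mathbb N_0$. The polynomials $\widetilde P_n^{(\lambda)}$ are evaluated at a matrix $\mathcal X$ with the variable on the right: $\widetilde P_n(\mathcal X)=\sum_kA_{n,k}\mathcal X^k$. That a 4-tuple $(\widetilde P_n,\widetilde M_1,\widetilde M_2,\widetilde\nu)$ is dual to $Q_x^{(\lambda)}$ means: $Q_x^{(\lambda)}(\rho(n))=\widetilde M_1(n)\widetilde P_n(\widetilde\nu(x))\widetilde M_2(x)$ for all $x,n\in\mathbb N_0$, with $\widetilde M_1(0)=\widetilde M_2(0)=I$, and the $\widetilde P_n$ satisfy a monic three term recurrence $\widetilde P_n(\widetilde\nu(x))\widetilde\nu(x)=\widetilde P_{n+1}(\widetilde\nu(x))+\widetilde B_n\widetilde P_n(\widetilde\nu(x))+\widetilde C_n\widetilde P_{n-1}(\widetilde\nu(x))$ with matrices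 $\widetilde B_n,\widetilde C_n$. *)

(* Defs.v *)
From HB Require Import structures.
From mathcomp Require Import all_boot all_order all_algebra.
From mathcomp Require Import complex.
From mathcomp Require Import all_classical all_reals all_analysis.

Set Implicit Arguments.
Unset Strict Implicit.
Unset Printing Implicit Defensive.

Import Order.TTheory GRing.Theory Num.Theory.
Import numFieldNormedType.Exports.
Local Open Scope ring_scope.
Local Open Scope sesquilinear_scope.

(* An N x N matrix, N >= 1, has type 'M_m.+1 with N = m.+1: this is the form
   for which MathComp square matrices are a (nonzero) ring.  Scalars in matrix
   expressions are c%:M, or n%:R for natural numbers, and M^-1 is the matrix
   inverse.  The positive reals a, mu_k are elements of C that are > 0 (in a
   numClosedFieldType this entails that they are real).  The row and column
   indices of the text start at 1, those of 'I_m.+1 at 0. *)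

Section MatrixPolynomials.
Variables (C : numClosedFieldType) (m : nat).
Local Notation M := 'M[C]_m.+1.

Definition monic_of_degree (n : nat) (P : {poly M}) : Prop :=
  P \is monic /\ size P = n.+1.

(* Evaluation of sum_k 'X^k A_k with the variable on the left of the
   coefficients; P.[X] is evaluation with the variable on the right. *)
Definition left_eval (P : {poly M}) (X : M) : M :=
  \sum_(k < size P) X ^+ k * P`_k.

(* The term of index n - 1, with the convention that the term of index -1
   is 0. *)
Definition prev_poly (P : nat -> {poly M}) (n : nat) : {poly M} :=
  if n is n'.+1 then P n' else 0.

Definition posdefmx (D : M) : Prop :=
  D ^t* = D /\
  forall v : 'rV[C]_m.+1, v != 0 -> 0 < (v *m D *m v ^t*) 0 0.

(* The matrix sum_x P(x) w(x) Q(x)^*, entry by entry; limn is meaningful only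
   when the series converges, which holds for the weight defined below. *)
Definition orthogonality_sum (w : nat -> M) (P Q : {poly M}) : M :=
  \matrix_(i, j)
    limn (series (fun x : nat => (P.[x%:R] * w x * Q.[x%:R] ^t*) i j)).

Definition is_dual (Q : nat -> {poly M}) (rho : nat -> M)
    (P : nat -> {poly M}) (M1 M2 : nat -> M) (nu : nat -> M) : Prop :=
  [/\ forall x n, left_eval (Q x) (rho n) = M1 n * (P n).[nu x] * M2 x,
      M1 0%N = 1,
      M2 0%N = 1
    & exists B E : nat -> M, forall n x,
        (P n).[nu x] * nu x =
          (P n.+1).[nu x] + B n * (P n).[nu x] + E n * (prev_poly P n).[nu x]].

(* A sequence defined by such a recurrence consists of monic polynomials of the
   expected degrees. *)
Lemma monic_of_recurrence (P : nat -> {poly M}) (B E : nat -> M) :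
    P 0%N = 1 ->
    (forall n, 'X * P n = P n.+1 + (B n)%:P * P n + (E n)%:P * prev_poly P n) ->
  forall n, monic_of_degree n (P n).
Proof.
move=> P0 PS.
have leC (c : M) (p : {poly M}) : (size (c%:P * p)%R <= size p)%N.
  by rewrite mul_polyC size_scale_leq.
have step n : P n.+1 = 'X * P n - ((B n)%:P * P n + (E n)%:P * prev_poly P n).
  by apply/eqP; rewrite eq_sym subr_eq addrA -PS.
suff H n : monic_of_degree n (P n) /\ (size (prev_poly P n) <= n)%N.
  by move=> n; case: (H n).
elim: n => [|n [[mP sP] sp]].
  by rewrite /monic_of_degree P0 monic1 size_poly1 size_poly0.
have sX : size ('X * P n) = n.+2.
  by rewrite -commr_polyX size_mulX ?sP // -size_poly_eq0 sP.
have sR : (size (- ((B n)%:P * P n + (E n)%:P * prev_poly P n)) < size ('X * P n)%R)%N.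
  rewrite size_polyN sX ltnS (leq_trans (size_polyD _ _)) // geq_max.
  rewrite (leq_trans (leC _ _)) ?sP //= (leq_trans (leC _ _)) //.
  exact: leq_trans sp _.
split; last by rewrite /= sP.
split; last by rewrite step size_polyDl // sX.
apply/eqP; rewrite step lead_coefDl //.
by rewrite -commr_polyX lead_coefMX; apply/eqP.
Qed.

End MatrixPolynomials.

Section MatrixCharlier.
Variables (C : numClosedFieldType) (m : nat) (a : C) (mu : nat -> C).
Variable lambda : nat.
Local Notation M := 'M[C]_m.+1.

Definition mu_condition : Prop :=
  (forall k : nat, (1 <= k <= m.+1)%N -> 0 < mu k) /\
  (forall j k : nat, (1 <= j <= m.+1)%N -> (1 <= k <= m.+1)%N ->
     (mu j / mu k) ^+ 2 =
       a ^ (k%:Z - j%:Z) * ((m.+1 - k)`!%:R / (m.+1 - j)`!%:R)).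

Definition delta (k : nat) : C :=
  (a / 2) ^+ lambda * ((lambda + k - 1)`!%:R / (k - 1)`!%:R).

Definition Amx : M :=
  \matrix_(i, j) if i == j.+1 :> nat then mu i.+1 / mu j.+1 else 0.

Definition Jmx : M := diag_mx (\row_i i.+1%:R).

Definition Tmx : M := diag_mx (\row_i delta i.+1).

Definition L0 : M :=
  \matrix_(i, j)
    if (j <= i)%N then
      mu i.+1 / mu j.+1 * ((- a) ^+ (i - j) / (i - j)`!%:R)
    else 0.

Definition weight (x : nat) : M :=
  (a ^+ x / x`!%:R) *:
    ((1 + Amx) ^+ (x + lambda) * Tmx * (1 + Amx ^t*) ^+ (x + lambda)).

Definition inner (P Q : {poly M}) : M := orthogonality_sum weight P Q.

Definition monic_orthogonal (P : nat -> {poly M}) : Prop :=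
  (forall n, monic_of_degree n (P n)) /\
  (forall n k, n != k -> inner (P n) (P k) = 0).

Definition Jfrak (x : nat) : M :=
  Jmx + (x + lambda)%:R * (1 + Amx)^-1.

Definition Upsilon (x : nat) : M := a ^- x *: (1 + Amx) ^- x.

Definition rho (P : nat -> {poly M}) (n : nat) : M :=
  (P n).[0]^-1 * (a%:M * (1 + Amx) - Jmx - (n + lambda)%:R * (1 + Amx)^-1)
    * (P n).[0].

Definition norm_decomposition (P : nat -> {poly M}) (D : nat -> M) : Prop :=
  forall n,
    [/\ is_diag_mx (D n), posdefmx (D n)
      & inner (P n) (P n) =
          L0^-1 * (1 + Amx) ^+ (n + lambda) * D n
            * (1 + Amx ^t*) ^+ (n + lambda) * (L0 ^t*)^-1].

Definition Q_condition (P Q : nat -> {poly M}) : Prop :=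
  forall x, monic_of_degree x (Q x) /\
    forall n,
      left_eval (Q x) (rho P n) =
        (P n).[0]^-1 * (P n).[x%:R] * (Upsilon x)^-1.

End MatrixCharlier.

(* Main.v *)
Require Import Defs.
From mathcomp Require Import all_boot all_order all_algebra.
From mathcomp Require Import complex ring.
From mathcomp Require Import all_classical all_reals all_analysis.

Set Implicit Arguments.
Unset Strict Implicit.
Unset Printing Implicit Defensive.

Import Order.TTheory GRing.Theory Num.Theory.
Import numFieldNormedType.Exports.
Local Open Scope ring_scope.
Local Open Scope sesquilinear_scope.

(** Write N for 1 + A, and H_n for the norm of P_n.  Because Q_x(rho(n)) is
    given by P_n(x), the duality amounts to P_n(x) = N^n Pt_n(Jf(x)) for every
    natural x, where Jf(x) = J + (x + lambda) N^-1.  This follows by induction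
    on n once P_n(x) Jf(x) is known to be a combination of P_(n+1)(x), P_n(x)
    and P_(n-1)(x) with the same coefficients as the recurrence of Pt_n,
    conjugated by N^n (mulJ_expansion, dual_coefB, dual_coefC).

    Two properties of the weight W produce that expansion.

    - J A - A J = A gives Jf(x) N^(x+lambda) = N^(x+lambda) (J + x + lambda).
      The diagonal factor J + x + lambda commutes with T, so Jf(x) W(x) is its
      own conjugate transpose, and right multiplication by Jf is a symmetric
      operator for the inner product (inner_mulJ).

    - (x + 1) N^-1 W(x+1) = a W(x) N^*, so that shift_down, which sends U to
      x U(x-1) N^-1, is adjoint to shift_up, which sends U to a U(x+1) N
      (inner_shift_down).

    Since shift_up preserves degrees while shift_down raises them by one,
    shift_down P_n involves P_(n+1) and P_n only, with coefficients N^-1 and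
    a H_n N^* H_n^-1.  The difference P_n Jf - shift_down P_n has degree at most
    n: the terms of degree n + 1 cancel, and the coefficient of degree n is read
    off from the discrete derivative of P_n.  By symmetry it is orthogonal to
    P_k for k < n - 1, hence a combination of P_n and P_(n-1).  Splitting P_n Jf
    in this way avoids the subleading coefficients of P_n altogether.

    The factorization of H_n and the fact that L_0 is a polynomial in A (it is
    exp (- a A), and A is nilpotent) finally turn the coefficients in H_n into
    those in D_n.

    All inner products converge because A is nilpotent: N^x is then polynomial
    in x, and every series is a combination of polynomial moments of a^x / x!,
    which reduce to the exponential series. *)

(** * Entrywise convergent series of matrices *)

Section MatrixSeries.
Variables (C : numClosedFieldType) (m : nat).
Local Notation M := 'M[C]_m.+1.

(** Carrying the sum along makes every rule below state the convergence and the
    value of a series at once, whereas limn says nothing without convergence. *)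
Definition is_mxsum (f : nat -> M) (S : M) : Prop :=
  forall i j, (series (fun x => f x i j) @ \oo --> S i j)%classic.

Lemma is_mxsum_unique f S T : is_mxsum f S -> is_mxsum f T -> S = T.
Proof.
move=> fS fT; apply/matrixP => i j.
exact: (cvg_unique (@norm_hausdorff _ C) (fS i j) (fT i j)).
Qed.

Lemma eq_is_mxsum f g S : f =1 g -> is_mxsum f S -> is_mxsum g S.
Proof. by move=> /funext ->. Qed.

Lemma is_mxsum0 : is_mxsum (fun=> 0) 0.
Proof.
move=> i j; rewrite (_ : series _ = cst 0).
  by rewrite mxE; exact: cvg_cst.
by apply/funext => n; rewrite /series /= big1 // => k _; rewrite mxE.
Qed.

Lemma is_mxsumD f g S T :
  is_mxsum f S -> is_mxsum g T -> is_mxsum (fun x => f x + g x) (S + T).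
Proof.
move=> fS gT i j; rewrite mxE.
rewrite (_ : series _ =
    (fun n => series (fun x => f x i j) n + series (fun x => g x i j) n));
  last first.
  apply/funext => n; rewrite /series /= -big_split /=.
  by apply: eq_bigr => k _; rewrite mxE.
exact: cvgD.
Qed.

Lemma is_mxsumZ c f S : is_mxsum f S -> is_mxsum (fun x => c *: f x) (c *: S).
Proof.
move=> fS i j; rewrite mxE.
rewrite (_ : series _ = (fun n => c * series (fun x => f x i j) n)); last first.
  apply/funext => n; rewrite /series /= mulr_sumr.
  by apply: eq_bigr => k _; rewrite mxE.
by apply: cvgM => //; exact: cvg_cst.
Qed.

Lemma is_mxsum_sum (I : Type) (r : seq I) (f : I -> nat -> M) (S : I -> M) :
    (forall k, is_mxsum (f k) (S k)) ->
  is_mxsum (fun x => \sum_(k <- r) f k x) (\sum_(k <- r) S k).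
Proof.
move=> fS; elim: r => [|k r IH].
  rewrite big_nil; apply: (eq_is_mxsum _ is_mxsum0) => x.
  by rewrite big_nil.
rewrite big_cons; apply: (eq_is_mxsum _ (is_mxsumD (fS k) IH)) => x.
by rewrite big_cons.
Qed.

Lemma is_mxsum_mul c d f S :
  is_mxsum f S -> is_mxsum (fun x => c * f x * d) (c * S * d).
Proof.
(* Each entry of the product is a finite combination of entries of X. *)
have key (X : M) i j :
    (c * X * d) i j = \sum_k \sum_l (c i k * d l j) * X k l.
  rewrite exchange_big /= !mxE; apply: eq_bigr => l _.
  rewrite !mxE mulr_suml; apply: eq_bigr => k _.
  by rewrite mulrAC.
move=> fS i j; rewrite key.
have fS' : is_mxsum
   (fun x => \sum_k \sum_l const_mx (c i k * d l j * f x k l))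
   (\sum_k \sum_l const_mx (c i k * d l j * S k l)).
  apply: is_mxsum_sum => k; apply: is_mxsum_sum => l i' j'.
  rewrite mxE.
  rewrite (_ : series _ =
      (fun n => c i k * d l j * series (fun x => f x k l) n)).
    by apply: cvgM; [exact: cvg_cst|exact: fS].
  apply/funext => n; rewrite /series /= mulr_sumr.
  by apply: eq_bigr => x _; rewrite mxE.
have E (X : M) :
    (\sum_k \sum_l const_mx (c i k * d l j * X k l) : M) i j = (c * X * d) i j.
  rewrite key summxE; apply: eq_bigr => k _.
  by rewrite summxE; apply: eq_bigr => l _; rewrite mxE.
by move: (fS' i j); rewrite E key; under eq_fun do rewrite E.
Qed.

Lemma is_mxsum_shift f S :
  is_mxsum (fun x => f x.+1) S <-> is_mxsum f (f 0%N + S).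
Proof.
have E i j n : series (fun x => f x i j) n.+1 =
    f 0%N i j + series (fun x => f x.+1 i j) n.
  by rewrite /series /= big_nat_recl //.
split=> fS i j.
  rewrite -cvg_shiftS.
  rewrite (_ : [sequence _]_n =
      fun n => f 0%N i j + series (fun x => f x.+1 i j) n).
    by rewrite mxE; apply: cvgD; [exact: cvg_cst|exact: fS].
  by apply/funext => n; rewrite -E.
rewrite (_ : series _ = fun n => series (fun x => f x i j) n.+1 - f 0%N i j).
  rewrite (_ : S i j = (f 0%N + S) i j - f 0%N i j);
    last by rewrite mxE addrC addKr.
  apply: cvgB; last exact: cvg_cst.
  by have := fS i j; rewrite -(cvg_shiftS (series _)).
by apply/funext => n; rewrite E addrC addKr.
Qed.

Lemma is_mxsum_inner (w : nat -> M) (P Q : {poly M}) S :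
    is_mxsum (fun x => P.[x%:R] * w x * Q.[x%:R] ^t*) S ->
  orthogonality_sum w P Q = S.
Proof.
move=> PQS; apply/matrixP => i j; rewrite mxE.
exact: (cvg_lim (@norm_hausdorff _ C) (PQS i j)).
Qed.

End MatrixSeries.

Arguments is_mxsum_mul {C m} c d {f S} _.
Arguments is_mxsumZ {C m} c {f S} _.

(** * Shifting the argument of a polynomial over a noncommutative ring *)

Section PolynomialShift.
Variable T : nzRingType.
Implicit Types (p : {poly T}) (h x : T).

(** The Taylor formula for p(x + h): for coefficients in a matrix ring this is
    easier to evaluate than the composition of p with 'X + h. *)
Definition poly_shift h p : {poly T} := \sum_(i < size p) h ^+ i *: p^`N(i).

Lemma horner_poly_shift h p x :
  (forall y, GRing.comm h y) -> (poly_shift h p).[x] = p.[x + h].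
Proof.
move=> hC; rewrite nderiv_taylor; last exact/commr_sym/hC.
rewrite horner_sum; apply: eq_bigr => i _; rewrite hornerZ.
by apply/commr_sym/commrX/commr_sym/hC.
Qed.

(** The two top coefficients of the shift only see the Taylor terms of order 0
    and 1, because the derivative of order i loses i degrees. *)
Lemma coef_poly_shift h p k :
  (size p <= k.+2)%N -> (poly_shift h p)`_k = p`_k + h * (p`_k.+1 *+ k.+1).
Proof.
move=> sp; rewrite /poly_shift coef_sum.
rewrite (eq_bigr (fun i : 'I__ => h ^+ i * (p`_(i + k) *+ 'C(i + k, i)))).
  rewrite -(big_mkord xpredT (fun i => h ^+ i * (p`_(i + k) *+ 'C(i + k, i)))).
  set F := BIG_F.
  have F0 i : (1 < i)%N -> F i = 0.
    move=> i1; rewrite /F nth_default ?mul0rn ?mulr0 //.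
    by rewrite (leq_trans sp) // -add2n leq_add2r.
  have F0' i : (size p <= i)%N -> F i = 0.
    move=> i1; rewrite /F nth_default ?mul0rn ?mulr0 //.
    by rewrite (leq_trans i1) // leq_addr.
  (* Two vanishing terms are added, so that F 0 and F 1 exist for every p. *)
  transitivity (\sum_(0 <= i < (size p).+2) F i).
    by rewrite !big_nat_recr //= !F0' // !addr0.
  rewrite big_nat_recl // big_nat_recl // big1 ?addr0;
    last by move=> i _; exact: F0.
  by rewrite /F expr0 mul1r add0n bin0 mulr1n expr1 add1n bin1.
by move=> i _; rewrite coefZ coef_nderivn.
Qed.

Lemma size_poly_shift h p : (size (poly_shift h p) <= size p)%N.
Proof.
apply/leq_sizeP => k sk.
rewrite coef_poly_shift ?nth_default ?mul0rn ?mulr0 ?addr0 //.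
  by rewrite (leq_trans sk).
by rewrite (leq_trans sk) // -addn2 leq_addr.
Qed.

Lemma coef_poly_shift_lead h p k :
  (size p <= k.+1)%N -> (poly_shift h p)`_k = p`_k.
Proof.
move=> sp; rewrite coef_poly_shift 1?(leq_trans sp) //.
by rewrite [p`_k.+1]nth_default // mul0rn mulr0 addr0.
Qed.

Lemma hornerM_nat p q n : (p * q).[n%:R] = p.[n%:R] * q.[n%:R].
Proof. by apply: hornerM_comm; exact/commr_sym/commr_nat. Qed.

End PolynomialShift.

(** * Conjugate transposition *)

Section ConjugateTranspose.
Variables (C : numClosedFieldType) (m : nat).
Implicit Types X Y : 'M[C]_m.+1.

Lemma trmxC_mul X Y : (X * Y) ^t* = Y ^t* * X ^t*.
Proof. by rewrite -!mulmxE trmx_mul map_mxM. Qed.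

Lemma trmxCD X Y : (X + Y) ^t* = X ^t* + Y ^t*.
Proof. by rewrite linearD /= map_mxD. Qed.

Lemma trmxCZ c X : (c *: X) ^t* = c^* *: X ^t*.
Proof. by rewrite linearZ /= map_mxZ. Qed.

Lemma trmxC1 : (1 : 'M[C]_m.+1) ^t* = 1.
Proof. by rewrite trmx1 map_mx1. Qed.

Lemma trmxC_nat n : (n%:R : 'M[C]_m.+1) ^t* = n%:R.
Proof. by rewrite -scaler_nat trmxCZ trmxC1 conjC_nat. Qed.

Lemma trmxCX X n : (X ^+ n) ^t* = X ^t* ^+ n.
Proof.
elim: n => [|n IH]; first exact: trmxC1.
by rewrite exprSr trmxC_mul IH exprS.
Qed.

Lemma trmxC_sum (I : Type) (r : seq I) (F : I -> 'M[C]_m.+1) :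
  (\sum_(i <- r) F i) ^t* = \sum_(i <- r) (F i) ^t*.
Proof. by rewrite raddf_sum raddf_sum. Qed.

Lemma unitr_trmxC X : (X ^t* \is a GRing.unit) = (X \is a GRing.unit).
Proof.
rewrite -[LHS]/(_ \in unitmx) -[RHS]/(_ \in unitmx).
by rewrite map_unitmx unitmx_tr.
Qed.

Lemma trmxCV X : (X^-1) ^t* = (X ^t*)^-1.
Proof. by rewrite trmx_inv map_invmx. Qed.

End ConjugateTranspose.

(** * Polynomial sequences and their moments against a^x / x! *)

Section PolynomialSequences.
Variables (C : numClosedFieldType) (m : nat).
Local Notation M := 'M[C]_m.+1.

Definition is_polyseq (f : nat -> M) : Prop :=
  exists V : {poly M}, forall x, f x = V.[x%:R].

Lemma is_polyseq_poly (V : {poly M}) : is_polyseq (fun x => V.[x%:R]).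
Proof. by exists V. Qed.

Lemma is_polyseq_cst c : is_polyseq (fun=> c).
Proof. by exists c%:P => x; rewrite hornerC. Qed.

Lemma is_polyseqM f g :
  is_polyseq f -> is_polyseq g -> is_polyseq (fun x => f x * g x).
Proof.
move=> [U fU] [V gV]; exists (U * V) => x.
by rewrite fU gV hornerM_nat.
Qed.

Lemma is_polyseq_sum (I : Type) (r : seq I) (f : I -> nat -> M) :
  (forall i, is_polyseq (f i)) -> is_polyseq (fun x => \sum_(i <- r) f i x).
Proof.
move=> fP; elim: r => [|i r [V IH]].
  by exists 0 => x; rewrite big_nil horner0.
by have [U fU] := fP i; exists (U + V) => x; rewrite big_cons hornerD fU IH.
Qed.

Lemma is_polyseq_trmxC f : is_polyseq f -> is_polyseq (fun x => (f x) ^t*).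
Proof.
move=> [V fV]; exists (\poly_(k < size V) (V`_k) ^t*) => x.
rewrite fV horner_coef horner_poly trmxC_sum; apply: eq_bigr => k _.
by rewrite trmxC_mul trmxCX trmxC_nat -natrX (commr_nat (_ ^t*)).
Qed.

Lemma is_polyseq_bin j : is_polyseq (fun x => 'C(x, j)%:R).
Proof.
elim: j => [|j [V IH]]; first by exists 1 => x; rewrite bin0 hornerC.
exists (((j.+1%:R)^-1 : C)%:M%:P * (('X - (j%:R)%:P) * V)) => x.
rewrite !hornerM_nat hornerC hornerXsubC -IH -mulmxE mul_scalar_mx mulmxE.
have -> : (x%:R - j%:R) * 'C(x, j)%:R = 'C(x, j.+1)%:R *+ j.+1 :> M.
  rewrite -mulrnA mulnC mul_bin_left natrM; have [jx|xj] := leqP j x.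
    by rewrite natrB.
  by rewrite bin_small // !mulr0.
by rewrite -(@scaler_nat C M j.+1) scalerA mulVf ?scale1r // pnatr_eq0.
Qed.

(** In the binomial expansion of (1 + A)^x only the powers of A up to m survive,
    and binomial coefficients are polynomial in their upper index. *)
Lemma is_polyseq_unipotent (A : M) (l : nat) :
  A ^+ m.+1 = 0 -> is_polyseq (fun x => (1 + A) ^+ (x + l)).
Proof.
move=> A0; have Ak k : (m < k)%N -> A ^+ k = 0.
  by move=> mk; rewrite -(subnK mk) exprD A0 mulr0.
suff [V EV] : is_polyseq (fun x => \sum_(i < m.+1) A ^+ i * 'C(x, i)%:R).
  have [U EU] :=
    is_polyseqM (is_polyseq_poly V) (is_polyseq_cst ((1 + A) ^+ l)).
  exists U => x; rewrite -EU -EV exprD addrC exprD1n; congr (_ * _).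
  (* The binomial sum stops at x, the target at m: both extend by zeros. *)
  transitivity (\sum_(i < x.+1 + m.+1) A ^+ i * 'C(x, i)%:R).
    rewrite big_split_ord /= [X in _ + X]big1 ?addr0.
      by apply: eq_bigr => i _; rewrite mulr_natr.
    by move=> i _; rewrite bin_small ?mulr0 // leq_addr.
  rewrite addnC big_split_ord /= [X in _ + X]big1 ?addr0 // => i _.
  by rewrite Ak ?mul0r // leq_addr.
apply: is_polyseq_sum => i; apply: is_polyseqM; first exact: is_polyseq_cst.
exact: is_polyseq_bin.
Qed.

(** Induction on the degree: in V = W X + c the constant contributes a multiple
    of the exponential series, and x W(x) a^x / x! at x + 1 is
    a W(x + 1) a^x / x!, where W(x + 1) has smaller degree than V. *)
Lemma is_mxsum_poisson (a : C) (V : {poly M}) :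
    cvgn (series (fun x => a ^+ x / x`!%:R)) ->
  exists S, is_mxsum (fun x => (a ^+ x / x`!%:R) *: V.[x%:R]) S.
Proof.
move=> /cvg_ex[/= e ae].
have cstE (c : M) : is_mxsum (fun x => (a ^+ x / x`!%:R) *: c) (e *: c).
  move=> i j; rewrite mxE; set s := series _.
  rewrite (_ : s = fun n => series (fun x => a ^+ x / x`!%:R) n * c i j).
    by apply: cvgM => //; exact: cvg_cst.
  apply/funext => n; rewrite /s /series /= mulr_suml.
  by apply: eq_bigr => x _; rewrite mxE.
have [n] := ubnP (size V); elim: n V => // n IH V; rewrite ltnS => sV.
have [W [c defV]] : exists W c, V = W * 'X + c%:P.
  exists (Poly (behead V)), V`_0; rewrite -cons_poly_def.
  by apply/polyP => -[|k];
    rewrite coef_cons //= coef_Poly nth_behead.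
(* For W = 0 the degree need not drop, and the induction stops there. *)
have sW : (size (poly_shift 1 W) < n)%N \/ V = c%:P.
  have [W0|W0] := eqVneq W 0; first by right; rewrite defV W0 mul0r add0r.
  left; apply: leq_ltn_trans (size_poly_shift _ _) _.
  move: sV; rewrite defV -cons_poly_def size_cons_poly /nilp size_poly_eq0.
  by rewrite (negPf W0).
case: sW => [/IH[S WS]|->]; last first.
  by exists (e *: c); apply: (eq_is_mxsum _ (cstE c)) => x; rewrite hornerC.
have {}WS :
    is_mxsum (fun x => (a ^+ x / x`!%:R) *: (W.[x%:R] * x%:R)) (0 + a *: S).
  rewrite -[0](_ : (a ^+ 0 / 0`!%:R) *: (W.[0%:R] * 0%:R) = 0 :> M); last first.
    by rewrite mulr0 scaler0.
  pose F x : M := (a ^+ x / x`!%:R) *: (W.[x%:R] * x%:R).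
  apply: (proj1 (is_mxsum_shift F (a *: S))).
  apply: (eq_is_mxsum _ (is_mxsumZ a WS)) => x.
  have x1 : x.+1%:R != 0 :> C by rewrite pnatr_eq0.
  have x2 : x`!%:R != 0 :> C by rewrite pnatr_eq0 -lt0n fact_gt0.
  rewrite horner_poly_shift; last by move=> y; exact/commr_sym/commr1.
  rewrite /F natr1 mulr_natr -(@scaler_nat C M x.+1 W.[_]) !scalerA.
  congr (_ *: _); rewrite exprS factS natrM.
  by field; rewrite ?nat1r ?natr1 x1 x2.
exists (0 + a *: S + e *: c).
apply: (eq_is_mxsum _ (is_mxsumD WS (cstE c))) => x.
by rewrite -scalerDr defV hornerD hornerC hornerM_nat hornerX.
Qed.

End PolynomialSequences.

(** * The exponential series over the complex numbers *)

(** The embedding of the reals into the complex numbers preserves norms, so it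
    carries over the convergence of the real exponential series. *)
Lemma is_cvg_series_exp_complex (R : realType)
    (C := R[i] : numClosedFieldType) (a : C) :
  0 < a -> cvgn (series (fun x => a ^+ x / x`!%:R)).
Proof.
move=> a_gt0; have [r ar] : exists r : R, a = r%:C%C.
  by exists (complex.Re a); rewrite RRe_real // gtr0_real.
have /cvg_ex[/= e re] := is_cvg_series_exp_coeff r.
have E n : series (fun x => a ^+ x / x`!%:R) n = (series (exp_coeff r) n)%:C%C.
  rewrite /series /= rmorph_sum; apply: eq_bigr => x _.
  by rewrite ar /exp_coeff /= fmorph_div rmorphXn rmorph_nat.
apply: (cvgP (e%:C%C : C)); apply/cvgrPdist_lt => eps eps_gt0.
have [d defd] : exists d : R, eps = d%:C%C.
  by exists (complex.Re eps); rewrite RRe_real // gtr0_real.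
move: eps_gt0; rewrite defd ltcR => d_gt0.
move/cvgrPdist_lt : re => /(_ _ d_gt0); apply: filterS => n.
by rewrite E -rmorphB normc_def /= expr0n /= addr0 sqrtr_sqr ltcR.
Qed.

(** * The matrices A, J and L_0 *)

Section LadderMatrix.
Variables (C : numClosedFieldType) (m : nat) (a : C) (mu : nat -> C).
Variable lambda : nat.
Hypothesis mu_gt0 : forall k : nat, (1 <= k <= m.+1)%N -> 0 < mu k.
Local Notation A := (Amx m mu).
Local Notation J := (Jmx C m).
Local Notation N := (1 + A).

Let mu_neq0 (i : 'I_m.+1) : mu i.+1 != 0.
Proof. by rewrite gt_eqF // mu_gt0 //= ltn_ord. Qed.

(** The entries of A telescope along its single nonzero subdiagonal. *)
Lemma Amx_exp k i j :
  (A ^+ k) i j = if i == (j + k)%N :> nat then mu i.+1 / mu j.+1 else 0.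
Proof.
elim: k i j => [|k IH] i j.
  rewrite mxE addn0 (inj_eq val_inj); case: eqVneq => [->|//].
  by rewrite divff.
rewrite exprSr -mulmxE mxE.
under eq_bigr do rewrite IH [A _ _]mxE.
have [ltj|gej] := ltnP j.+1 m.+1.
  rewrite (bigD1 (Ordinal ltj)) //= big1 ?addr0 => [|l].
    rewrite eqxx addSnnS; case: eqP => _; last by rewrite mul0r.
    by rewrite mulrA divfK // (mu_neq0 (Ordinal ltj)).
  rewrite -val_eqE /= => /negPf ->; by rewrite mulr0.
rewrite big1 => [|l _].
  rewrite ltn_eqF //; apply: leq_trans (ltn_ord i) (leq_trans gej _).
  by rewrite addnS ltnS leq_addr.
by case: (l =P j.+1 :> nat) (ltn_ord l) => [->|_ _]; rewrite ?mulr0 // ltnNge gej.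
Qed.

Lemma Amx_nilpotent : A ^+ m.+1 = 0.
Proof.
apply/matrixP => i j; rewrite Amx_exp mxE ifN //.
by rewrite neq_ltn (leq_trans (ltn_ord i)) // leq_addl.
Qed.

(** This is exp (- a A), truncated where the powers of A vanish; it shows that
    L_0 commutes with A. *)
Lemma L0_exp : L0 m a mu = \sum_(k < m.+1) ((- a) ^+ k / k`!%:R) *: A ^+ k.
Proof.
apply/matrixP => i j; rewrite mxE summxE.
under eq_bigr do rewrite mxE Amx_exp.
have [ji|ij] := leqP j i.
  have lt : (i - j < m.+1)%N by rewrite (leq_ltn_trans (leq_subr _ _)).
  rewrite (bigD1 (Ordinal lt)) //= subnKC // eqxx big1 ?addr0.
    exact: mulrC.
  move=> k; rewrite -val_eqE /= => kij; rewrite ifN ?mulr0 //.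
  by apply: contra kij => /eqP ->; rewrite addKn.
rewrite big1 // => k _; rewrite ifN ?mulr0 //.
by rewrite neq_ltn (leq_trans ij) // leq_addr.
Qed.

Lemma comm_L0_Amx : GRing.comm (L0 m a mu) A.
Proof.
rewrite L0_exp; apply/commr_sym/commr_sum => k _.
rewrite /GRing.comm -scalerAl -scalerAr; congr (_ *: _).
exact/commrX/commr_refl.
Qed.

Lemma comm_L0_N : GRing.comm (L0 m a mu) N.
Proof. by apply: commrD; [exact: commr1|exact: comm_L0_Amx]. Qed.

Lemma unit_L0 : L0 m a mu \is a GRing.unit.
Proof.
rewrite -[_ \is a _]/(_ \in unitmx) unitmxE det_trig; last first.
  by apply/is_trig_mxP => i j ij; rewrite mxE leqNgt ij.
rewrite big1 ?unitr1 // => i _.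
by rewrite mxE leqnn subnn expr0 fact0 divr1 mulr1 divff.
Qed.

Lemma unit_N : N \is a GRing.unit.
Proof.
rewrite -[_ \is a _]/(_ \in unitmx) unitmxE det_trig; last first.
  apply/is_trig_mxP => i j ij; rewrite !mxE -val_eqE (ltn_eqF ij) add0r.
  by rewrite ltn_eqF // ltnS ltnW.
rewrite big1 ?unitr1 // => i _.
by rewrite !mxE eqxx ltn_eqF // addr0.
Qed.

Lemma Jmx_Amx : J * A = A * J + A.
Proof.
apply/matrixP => i j; rewrite -!mulmxE mul_diag_mx mul_mx_diag !mxE.
case: eqP => [->|_]; last by rewrite !(mul0r, mulr0) addr0.
by rewrite -[j.+2%:R]natr1 mulrDl mul1r mulrC.
Qed.

Lemma trmxC_Jmx : J ^t* = J.
Proof.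
apply/matrixP => i j; rewrite !mxE eq_sym; case: eqP => [->|_].
  by rewrite !mulr1n conjC_nat.
by rewrite !mulr0n conjC0.
Qed.

Lemma comm_Jmx_Tmx : J * Tmx m a lambda = Tmx m a lambda * J.
Proof.
rewrite -!mulmxE !mulmx_diag; congr diag_mx; apply/rowP => i.
by rewrite !mxE mulrC.
Qed.

(** Conjugation by N^k turns Jfrak(x), for k = x + lambda, into a diagonal
    matrix: J N = N J + N - 1, and each factor N moved across adds 1. *)
Lemma J_conj k : (J + k%:R * N^-1) * N ^+ k = N ^+ k * (J + k%:R).
Proof.
have JN : J * N = N * J + N - 1.
  by rewrite mulrDr mulr1 Jmx_Amx mulrDl mul1r -!addrA; congr (_ + (_ + _));
    rewrite addrC subrK.
elim: k => [|k IH]; first by rewrite !expr0 mul0r mulr1 mul1r.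
have -> : (J + k.+1%:R * N^-1) * N ^+ k.+1 =
    (J + k%:R * N^-1) * N ^+ k * N + N ^+ k.
  rewrite -[k.+1%:R]natr1 [(_ + 1) / _]mulrDl mul1r addrA mulrDl exprSr !mulrA.
  congr (_ + _).
  by rewrite -mulrA -exprSr exprS mulKr ?unit_N.
rewrite IH exprSr -!mulrA -[X in _ + X]mulr1 -mulrDr; congr (_ * _).
rewrite mulrDl JN -(commr_nat N k) -[k.+1%:R]natr1.
rewrite mulrDr [N * (_ + 1)]mulrDr mulr1.
by rewrite addrAC subrK -addrA [N + _]addrC.
Qed.

End LadderMatrix.

(** * Expansions in orthogonal matrix polynomials *)

Section OrthogonalExpansion.
Variables (C : numClosedFieldType) (m : nat).
Local Notation M := 'M[C]_m.+1.
Variable ip : {poly M} -> {poly M} -> M.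
Hypothesis ipDl : forall U V W, ip (U + V) W = ip U W + ip V W.
Hypothesis ipDr : forall U V W, ip U (V + W) = ip U V + ip U W.
Hypothesis ipMl : forall c U V, ip (c%:P * U) V = c * ip U V.
Hypothesis ipMr : forall c U V, ip U (c%:P * V) = ip U V * c ^t*.
Variable P : nat -> {poly M}.
Hypothesis P_monic : forall n, monic_of_degree n (P n).
Hypothesis P_orth : forall n k, n != k -> ip (P n) (P k) = 0.
Hypothesis P_unit : forall n, ip (P n) (P n) \is a GRing.unit.

Lemma lead_decomposition n (U : {poly M}) : (size U <= n.+1)%N ->
  exists2 V : {poly M}, (size V <= n)%N & U = (U`_n)%:P * P n + V.
Proof.
move=> sU; have [/monicP lP sP] := P_monic n.
exists (U - (U`_n)%:P * P n); last by rewrite addrC subrK.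
apply/leq_sizeP => k; rewrite leq_eqVlt coefB coefCM => /predU1P[<-|nk].
  by move: lP; rewrite /lead_coef sP /= => ->; rewrite mulr1 subrr.
rewrite nth_default ?(leq_trans sU) // [(P n)`_k]nth_default ?sP //.
by rewrite mulr0 subrr.
Qed.

Lemma ip_lower n (U : {poly M}) : (size U <= n)%N ->
  ip (P n) U = 0 /\ ip U (P n) = 0.
Proof.
have ip0l V : ip 0 V = 0 by rewrite -(mul0r 0) -polyC0 ipMl mul0r.
have ip0r V : ip V 0 = 0.
  by have := ipMr 0 V 0; rewrite mulr0 trmx0 map_mx0 mulr0.
suff H k : (k <= n)%N -> (size U <= k)%N -> ip (P n) U = 0 /\ ip U (P n) = 0.
  exact: H.
elim: k U => [|k IH] U kn.
  by rewrite size_poly_leq0 => /eqP ->.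
move=> /lead_decomposition[V sV ->].
have [IH1 IH2] := IH V (ltnW kn) sV.
rewrite ipDl ipDr ipMl ipMr IH1 IH2 !addr0.
by rewrite P_orth ?gtn_eqF // P_orth ?ltn_eqF // mul0r mulr0.
Qed.

Lemma ip_lead n (U : {poly M}) : (size U <= n.+1)%N ->
  ip (P n) U = ip (P n) (P n) * (U`_n) ^t* /\
  ip U (P n) = U`_n * ip (P n) (P n).
Proof.
move=> /lead_decomposition[V /ip_lower[V1 V2] defU].
by rewrite {1 3}defU ipDl ipDr ipMl ipMr V1 V2 !addr0.
Qed.

(** Pairing with P_(n-1) exposes the top coefficient of U, which therefore
    vanishes; the degree drops and one goes on. *)
Lemma ip_eq0 n (U : {poly M}) : (size U <= n)%N ->
  (forall k, (k < n)%N -> ip U (P k) = 0) -> U = 0.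
Proof.
elim: n U => [|n IH] U sU U0; first by apply/eqP; rewrite -size_poly_leq0.
apply: IH => [|k kn]; last by apply: U0; rewrite ltnW.
have [V sV defU] := lead_decomposition sU.
have := U0 n (ltnSn n); have [_ ->] := ip_lead sU.
move/(canRL (mulrK (P_unit n))); rewrite mul0r => Un.
by rewrite defU Un mul0r add0r.
Qed.

(** After removing the top coefficients at P_n and P_(n-1), the remainder has
    degree less than n - 1 and is orthogonal to all P_k of such degree.  For
    n = 0 the second coefficient is meaningless, but prev_poly is 0. *)
Lemma ip_expansion n (U : {poly M}) : (size U <= n.+1)%N ->
    (forall k, (k.+1 < n)%N -> ip U (P k) = 0) ->
  U = (U`_n)%:P * P n +
      (ip U (P n.-1) / ip (P n.-1) (P n.-1))%:P * prev_poly P n.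
Proof.
move=> sU U0; have [V sV defU] := lead_decomposition sU.
rewrite [LHS]defU; congr (_ + _).
have UV k : (k < n)%N -> ip U (P k) = ip V (P k).
  by move=> kn; rewrite defU ipDl ipMl P_orth ?gtn_eqF // mulr0 add0r.
case: n sU U0 sV {defU} UV => [|n] sU U0 sV UV /=.
  by move: sV; rewrite size_poly_leq0 mulr0 => /eqP.
have [W sW defV] := lead_decomposition sV.
rewrite UV //; have [_ ->] := ip_lead sV; rewrite mulrK ?P_unit //.
rewrite {1}defV (ip_eq0 sW) ?addr0 // => k kn.
have := U0 k kn; rewrite (UV _ (ltnW kn)) defV ipDl ipMl.
by rewrite (P_orth (negbT (gtn_eqF kn))) mulr0 add0r.
Qed.

End OrthogonalExpansion.

(** * Two symmetries of the weight *)

Section CharlierInner.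
Variables (C : numClosedFieldType) (m : nat) (a : C) (mu : nat -> C).
Variable lambda : nat.
Hypothesis a_gt0 : 0 < a.
Hypothesis mu_gt0 : forall k : nat, (1 <= k <= m.+1)%N -> 0 < mu k.
Hypothesis exp_cvg : cvgn (series (fun x => a ^+ x / x`!%:R)).
Local Notation M := 'M[C]_m.+1.
Local Notation A := (Amx m mu).
Local Notation J := (Jmx C m).
Local Notation N := (1 + A).
Local Notation T := (Tmx m a lambda).
Local Notation W := (weight m a mu lambda).
Local Notation ip := (inner a mu lambda).

Lemma trmxC_N : N ^t* = 1 + A ^t*.
Proof. by rewrite trmxCD trmxC1. Qed.

Lemma weightE x :
  W x = (a ^+ x / x`!%:R) *: (N ^+ (x + lambda) * T * N ^t* ^+ (x + lambda)).
Proof. by rewrite trmxC_N. Qed.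

(** The general term is a^x / x! times a polynomial sequence, because N^x is
    polynomial in x. *)
Lemma inner_is_mxsum (P Q : {poly M}) :
  is_mxsum (fun x => P.[x%:R] * W x * Q.[x%:R] ^t*) (ip P Q).
Proof.
have [V EV] := is_polyseq_unipotent lambda (Amx_nilpotent mu_gt0).
have VP := is_polyseq_poly V.
have [U EU] := is_polyseqM (is_polyseqM (is_polyseq_poly P)
  (is_polyseqM (is_polyseqM VP (is_polyseq_cst T)) (is_polyseq_trmxC VP)))
  (is_polyseq_trmxC (is_polyseq_poly Q)).
have [S US] := is_mxsum_poisson U exp_cvg.
suff H : is_mxsum (fun x => P.[x%:R] * W x * Q.[x%:R] ^t*) S.
  by rewrite /ip (is_mxsum_inner H).
apply: eq_is_mxsum US => x.
by rewrite weightE -trmxCX EV -EU -scalerAr -scalerAl.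
Qed.

Arguments inner_is_mxsum P Q : clear implicits.

Lemma inner_eq (P Q P' Q' : {poly M}) :
    (forall x, P.[x%:R] * W x * Q.[x%:R] ^t* = P'.[x%:R] * W x * Q'.[x%:R] ^t*) ->
  ip P Q = ip P' Q'.
Proof.
move=> E; apply: (is_mxsum_unique (inner_is_mxsum P Q)).
by apply: eq_is_mxsum (inner_is_mxsum P' Q') => x; rewrite E.
Qed.

Lemma innerDl (U V Q : {poly M}) : ip (U + V) Q = ip U Q + ip V Q.
Proof.
apply: (is_mxsum_unique (inner_is_mxsum _ _)).
apply: (eq_is_mxsum _ (is_mxsumD (inner_is_mxsum U Q) (inner_is_mxsum V Q))) => x.
by rewrite hornerD !mulrDl.
Qed.

Lemma innerDr (Q U V : {poly M}) : ip Q (U + V) = ip Q U + ip Q V.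
Proof.
apply: (is_mxsum_unique (inner_is_mxsum _ _)).
apply: (eq_is_mxsum _ (is_mxsumD (inner_is_mxsum Q U) (inner_is_mxsum Q V))) => x.
by rewrite hornerD trmxCD !mulrDr.
Qed.

Lemma innerMl c (U V : {poly M}) : ip (c%:P * U) V = c * ip U V.
Proof.
apply: (is_mxsum_unique (inner_is_mxsum _ _)).
rewrite -[c * _]mulr1.
apply: (eq_is_mxsum _ (is_mxsum_mul c 1 (inner_is_mxsum U V))) => x.
by rewrite hornerM_nat hornerC mulr1 !mulrA.
Qed.

Lemma innerMr c (U V : {poly M}) : ip U (c%:P * V) = ip U V * c ^t*.
Proof.
apply: (is_mxsum_unique (inner_is_mxsum _ _)).
rewrite -[ip _ _ * _]mul1r mulrA.
apply: (eq_is_mxsum _ (is_mxsum_mul 1 (c ^t*) (inner_is_mxsum U V))) => x.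
by rewrite hornerM_nat hornerC mul1r trmxC_mul !mulrA.
Qed.

(** The polynomial U(x) Jfrak(x). *)
Definition mulJ (P : {poly M}) : {poly M} :=
  P * ('X * (N^-1)%:P + (J + lambda%:R * N^-1)%:P).

Lemma horner_mulJ P x : (mulJ P).[x%:R] = P.[x%:R] * Jfrak m mu lambda x.
Proof.
rewrite hornerM_nat hornerD hornerM_nat !hornerC hornerX; congr (_ * _).
by rewrite /Jfrak natrD mulrDl addrCA.
Qed.

(** Both sides are a^x / x! N^k (J + k) T (N^* )^k with k = x + lambda, since
    the diagonal matrices J + k and T commute. *)
Lemma Jfrak_weight x :
  Jfrak m mu lambda x * W x = W x * (Jfrak m mu lambda x) ^t*.
Proof.
rewrite weightE -scalerAr -scalerAl; congr (_ *: _).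
have TJ k : (J + k%:R) * T = T * (J + k%:R).
  by rewrite mulrDl mulrDr comm_Jmx_Tmx (commr_nat T k).
have key := @J_conj C m mu (x + lambda).
rewrite !mulrA key -[_ * _ * T]mulrA TJ -!mulrA; congr (_ * (_ * _)).
rewrite -trmxCX -trmxC_mul key trmxC_mul trmxCD trmxC_Jmx.
by rewrite trmxC_nat.
Qed.

Lemma inner_mulJ P Q : ip (mulJ P) Q = ip P (mulJ Q).
Proof.
apply: inner_eq => x; rewrite !horner_mulJ trmxC_mul.
by rewrite -(mulrA P.[_]) Jfrak_weight !mulrA.
Qed.

(** The Pearson equation of the weight; it makes shift_down and shift_up adjoint
    to each other. *)
Lemma weight_step x : x.+1%:R * (N^-1 * W x.+1) = a *: (W x * N ^t*).
Proof.
have x1 : x.+1%:R != 0 :> C by rewrite pnatr_eq0.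
have x2 : x`!%:R != 0 :> C by rewrite pnatr_eq0 -lt0n fact_gt0.
have -> : W x.+1 = (a / x.+1%:R) *: (N * (W x * N ^t*)).
  rewrite !weightE addSn [N ^+ _.+1]exprS [N ^t* ^+ _.+1]exprSr.
  rewrite -scalerAl -scalerAr scalerA !mulrA; congr (_ *: _).
  by rewrite exprS factS natrM; field; rewrite ?nat1r ?natr1 x1 x2.
rewrite -scalerAr mulKr ?unit_N // mulr_natl -(@scaler_nat C M x.+1 (_ *: _)).
by rewrite scalerA mulrCA divff // mulr1.
Qed.

Definition shift_up (P : {poly M}) : {poly M} := poly_shift 1 P * (a%:M * N)%:P.

Definition shift_down (P : {poly M}) : {poly M} :=
  poly_shift (-1) P * 'X * (N^-1)%:P.

(** Summation by shift: the term of index 0 on the left vanishes because of the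
    factor x, and the term of index x + 1 is the right term of index x. *)
Lemma inner_shift_down P Q : ip (shift_down P) Q = ip P (shift_up Q).
Proof.
have c1 (y : M) : GRing.comm 1 y by exact/commr_sym/commr1.
have cN1 (y : M) : GRing.comm (-1) y by exact/commr_sym/commrN1.
apply: (is_mxsum_unique (inner_is_mxsum _ _)).
pose F x := (shift_down P).[x%:R] * W x * Q.[x%:R] ^t*.
rewrite -[ip P _]add0r -[0](_ : F 0%N = 0); last first.
  by rewrite /F !hornerM_nat hornerX mulr0 !mul0r.
apply: (proj1 (is_mxsum_shift F _)).
apply: (eq_is_mxsum _ (inner_is_mxsum P (shift_up Q))) => x.
rewrite /F /shift_down /shift_up !hornerM_nat !hornerC hornerX.
rewrite !horner_poly_shift // -natr1 addrK natr1.
have -> : (Q.[x.+1%:R] * (a%:M * N)) ^t* = (a *: N ^t*) * Q.[x.+1%:R] ^t*.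
  rewrite trmxC_mul -mulmxE mul_scalar_mx trmxCZ.
  by rewrite (conj_Creal (gtr0_real a_gt0)).
by rewrite -!mulrA (mulrA (W x)) -scalerAr -weight_step !mulrA.
Qed.

End CharlierInner.

Lemma unit_posdefmx (C : numClosedFieldType) m (D : 'M[C]_m.+1) :
  posdefmx D -> D \is a GRing.unit.
Proof.
case=> _ pos; rewrite -[_ \is a _]/(_ \in unitmx) unitmxE unitfE.
apply/negP => /det0P[v v0 vD]; have := pos v v0.
by rewrite vD mul0mx mxE ltxx.
Qed.

Lemma monic_of_degree0 (C : numClosedFieldType) m (p : {poly 'M[C]_m.+1}) :
  monic_of_degree 0 p -> p = 1.
Proof.
move=> [/monicP + sp]; rewrite /lead_coef sp /= => p0.
by rewrite (size1_polyC (eq_leq sp)) p0.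
Qed.

(** * The expansion of P_n(x) Jfrak(x) *)

Section Recurrence.
Variables (C : numClosedFieldType) (m : nat) (a : C) (mu : nat -> C).
Variable lambda : nat.
Hypothesis a_gt0 : 0 < a.
Hypothesis mu_gt0 : forall k : nat, (1 <= k <= m.+1)%N -> 0 < mu k.
Hypothesis exp_cvg : cvgn (series (fun x => a ^+ x / x`!%:R)).
Local Notation M := 'M[C]_m.+1.
Local Notation A := (Amx m mu).
Local Notation J := (Jmx C m).
Local Notation N := (1 + A).
Local Notation ip := (inner a mu lambda).
Local Notation up := (shift_up a mu).
Local Notation down := (shift_down mu).
Local Notation mJ := (mulJ mu lambda).
Variable P : nat -> {poly M}.
Hypothesis P_orth : monic_orthogonal a mu lambda P.
Local Notation H n := (ip (P n) (P n)).
Hypothesis H_unit : forall n, H n \is a GRing.unit.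

Lemma coef_shift_down (U : {poly M}) k :
  (down U)`_k = (if k is k'.+1 then (poly_shift (-1) U)`_k' else 0) * N^-1.
Proof. by rewrite /shift_down coefMC coefMX; case: k. Qed.

Lemma coef_mulJ (U : {poly M}) k :
  (mJ U)`_k =
    (if k is k'.+1 then U`_k' else 0) * N^-1 + U`_k * (J + lambda%:R * N^-1).
Proof. by rewrite /mulJ mulrDr mulrA coefD !coefMC coefMX; case: k. Qed.

(** The term J + lambda N^-1 comes from Jfrak itself and k N^-1 from the leading
    coefficient of x (U(x) - U(x - 1)) N^-1. *)
Lemma coef_mulJ_sub_shift_down (U : {poly M}) k : (size U <= k.+1)%N ->
  (mJ U - down U)`_k = U`_k * (J + (k + lambda)%:R * N^-1).
Proof.
move=> sU; rewrite coefB coef_shift_down coef_mulJ natrD mulrDl.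
rewrite addrCA [in RHS]mulrDr addrAC; congr (_ + _).
case: k sU => [|k] sU; first by rewrite !mul0r mulr0 subrr.
rewrite coef_poly_shift // mulN1r mulrDl opprD addNKr mulNr opprK.
by rewrite mulrA mulr_natr.
Qed.

Let P_size n : size (P n) = n.+1.
Proof. by case: P_orth => /(_ n)[]. Qed.

Let P_lead n : (P n)`_n = 1.
Proof.
by case: P_orth => /(_ n)[/monicP]; rewrite /lead_coef => + sP; rewrite sP.
Qed.

Let P_high n k : (n < k)%N -> (P n)`_k = 0.
Proof. by move=> nk; rewrite nth_default ?P_size. Qed.

Let size_up k : (size (up (P k)) <= k.+1)%N.
Proof.
apply/leq_sizeP => j kj; rewrite coefMC nth_default ?mul0r //.
by rewrite (leq_trans (size_poly_shift _ _)) ?P_size.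
Qed.

Let size_down k : (size (down (P k)) <= k.+2)%N.
Proof.
apply/leq_sizeP => -[|j] // kj; rewrite coef_shift_down nth_default ?mul0r //.
by rewrite (leq_trans (size_poly_shift _ _)) ?P_size.
Qed.

Let size_mulJ k : (size (mJ (P k)) <= k.+2)%N.
Proof.
apply/leq_sizeP => -[|j] // kj; rewrite coef_mulJ !P_high ?mul0r ?addr0 //.
exact: ltnW.
Qed.

Let ipDl := innerDl lambda mu_gt0 exp_cvg.
Let ipDr := innerDr lambda mu_gt0 exp_cvg.
Let ipMl := innerMl lambda mu_gt0 exp_cvg.
Let ipMr := innerMr lambda mu_gt0 exp_cvg.
Let lower := ip_lower ipDl ipDr ipMl ipMr (proj1 P_orth) (proj2 P_orth).
Let lead := ip_lead ipDl ipDr ipMl ipMr (proj1 P_orth) (proj2 P_orth).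
Let expansion :=
  ip_expansion ipDl ipDr ipMl ipMr (proj1 P_orth) (proj2 P_orth) H_unit.

(** For k < n, shift_down P_n is orthogonal to P_k because shift_up P_k has
    degree at most k; for k = n only the top coefficient a N of shift_up P_n
    counts. *)
Lemma shift_down_expansion n :
  down (P n) = (N^-1)%:P * P n.+1 + (a *: (H n * N ^t* / H n))%:P * P n.
Proof.
have E k : ip (down (P n)) (P k) = ip (P n) (up (P k)).
  exact: inner_shift_down.
have := expansion (size_down n); rewrite coef_shift_down.
rewrite coef_poly_shift_lead ?P_size // P_lead mul1r /= E.
have [-> _] := lead (size_up n).
rewrite coefMC coef_poly_shift_lead ?P_size // P_lead mul1r.
rewrite -mulmxE mul_scalar_mx trmxCZ (conj_Creal (gtr0_real a_gt0)).
rewrite mulmxE -scalerAr -scalerAl; apply=> k kn.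
by rewrite E; have [->] := lower (leq_trans (size_up k) kn).
Qed.

(** Against P_k with k < n the shift drops out as above, and the symmetry of
    Jfrak moves it to P_k Jfrak, which has degree k + 1 and leading coefficient
    N^-1: only k = n - 1 contributes. *)
Lemma mulJ_sub_shift_down_expansion n :
  mJ (P n) - down (P n) = (J + (n + lambda)%:R * N^-1)%:P * P n +
     (H n * (N^-1) ^t* / H n.-1)%:P * prev_poly P n.
Proof.
have sV : (size (mJ (P n) - down (P n))%R <= n.+1)%N.
  apply/leq_sizeP => k nk.
  rewrite coef_mulJ_sub_shift_down ?P_size ?P_high ?mul0r //.
  exact: ltnW.
have E k : (k < n)%N -> ip (mJ (P n) - down (P n)) (P k) = ip (P n) (mJ (P k)).
  move=> kn; have := ipDl (mJ (P n) - down (P n)) (down (P n)) (P k).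
  rewrite subrK inner_mulJ // inner_shift_down // => ->.
  have [->] := lower (leq_trans (size_up k) kn).
  by rewrite addr0.
rewrite [LHS](expansion sV) => [|k kn]; last first.
  rewrite (E k (ltnW kn)).
  by have [->] := lower (leq_trans (size_mulJ k) kn).
rewrite coef_mulJ_sub_shift_down ?P_size // P_lead mul1r; congr (_ + _).
case: n sV E => [|n] sV E; first by rewrite /= !mulr0.
rewrite E //=; have [-> _] := lead (size_mulJ n).
by rewrite coef_mulJ P_lead mul1r P_high // mul0r addr0.
Qed.

Lemma mulJ_expansion n x :
  (P n).[x%:R] * Jfrak m mu lambda x =
    N^-1 * (P n.+1).[x%:R]
    + (J + (n + lambda)%:R * N^-1 + a *: (H n * N ^t* / H n)) * (P n).[x%:R]
    + (H n * (N^-1) ^t* / H n.-1) * (prev_poly P n).[x%:R].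
Proof.
rewrite -horner_mulJ -[mJ _](subrK (down (P n))) mulJ_sub_shift_down_expansion.
rewrite shift_down_expansion !hornerD !hornerM_nat !hornerC [in RHS]mulrDl.
set u := N^-1 * _; set v := (J + _) * _; set w := _ * (P n).[_].
by rewrite addrC -addrA -[RHS]addrA; congr (_ + _); rewrite addrA [w + v]addrC.
Qed.

End Recurrence.

(** * Conjugating the recurrence by N^n *)

Lemma conj_mulr_comm (R : unitRingType) (g k s : R) :
    g \is a GRing.unit -> k \is a GRing.unit -> GRing.comm k s ->
  g * k * s / (g * k) = g * s / g.
Proof.
move=> ug uk ks; rewrite invrM // -[g * k * s]mulrA ks.
by rewrite !mulrA mulrK.
Qed.

Lemma divr_mulr_comm (R : unitRingType) (g h k s : R) :
    h \is a GRing.unit -> k \is a GRing.unit -> s \is a GRing.unit ->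
    GRing.comm k s ->
  g * (s * k) / s / (h * k) = g / h.
Proof.
move=> uh uk us ks; rewrite invrM // -ks !mulrA mulrK //.
by rewrite mulrK.
Qed.

Section DualRecurrence.
Variables (C : numClosedFieldType) (m : nat) (a : C) (mu : nat -> C).
Variable lambda : nat.
Hypothesis a_gt0 : 0 < a.
Hypothesis mu_gt0 : forall k : nat, (1 <= k <= m.+1)%N -> 0 < mu k.
Hypothesis exp_cvg : cvgn (series (fun x => a ^+ x / x`!%:R)).
Local Notation M := 'M[C]_m.+1.
Local Notation A := (Amx m mu).
Local Notation J := (Jmx C m).
Local Notation N := (1 + A).
Local Notation ip := (inner a mu lambda).
Variable P : nat -> {poly M}.
Hypothesis P_orth : monic_orthogonal a mu lambda P.
Local Notation H n := (ip (P n) (P n)).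
Variable D : nat -> M.
Hypothesis D_cond : norm_decomposition a mu lambda P D.
Local Notation L := (L0 m a mu).

Let uL : L \is a GRing.unit := unit_L0 a mu_gt0.
Let uN : N \is a GRing.unit := unit_N m mu.
Let uD n : D n \is a GRing.unit.
Proof. by have [_ /unit_posdefmx] := D_cond n. Qed.

(** The norm H_n is G_n K_n, and K_n, built from N^* and L_0^* only, commutes
    with N^*: it cancels from the coefficients of the expansion. *)
Let G n := L^-1 * N ^+ (n + lambda) * D n.
Let K n := N ^t* ^+ (n + lambda) * (L ^t*)^-1.

Let uG n : G n \is a GRing.unit.
Proof. by rewrite unitrMl // unitrMl ?unitrX // unitrV. Qed.

Let uK n : K n \is a GRing.unit.
Proof.
have uNs : N ^t* \is a GRing.unit by rewrite unitr_trmxC.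
by rewrite unitrMl ?unitrX // unitrV unitr_trmxC.
Qed.

Let H_factor n : H n = G n * K n.
Proof. by have [_ _ ->] := D_cond n; rewrite /G /K trmxC_N -!mulrA. Qed.

Lemma norm_unit n : H n \is a GRing.unit.
Proof. by rewrite H_factor unitrMl. Qed.

Let comm_K n : GRing.comm (K n) (N ^t*).
Proof.
apply/commr_sym/commrM; first exact/commrX/commr_refl.
apply: commrV; rewrite /GRing.comm -!trmxC_mul.
by rewrite (comm_L0_N a mu_gt0).
Qed.

Let norm_conj n : H n * N ^t* / H n = G n * N ^t* / G n.
Proof. by rewrite !H_factor; exact: conj_mulr_comm. Qed.

Let norm_ratio n : H n.+1 * (N^-1) ^t* / H n = G n.+1 / G n.
Proof.
have KS : K n.+1 = N ^t* * K n by rewrite /K addSn exprS !mulrA.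
rewrite !H_factor trmxCV KS; apply: divr_mulr_comm => //.
by rewrite unitr_trmxC.
Qed.

(** Since L_0 commutes with N, the power N^n completes N^lambda to
    N^(n+lambda); this is how the factor N^n enters the coefficients. *)
Let G_conj n : (G n)^-1 * N ^+ n = (D n)^-1 * N ^- lambda * L.
Proof.
have LN : L * N ^+ n = N ^+ n * L by apply: commrX; exact: comm_L0_N.
rewrite /G !invrM ?unitrMl ?unitrX ?unitrV // invrK -!mulrA LN.
by rewrite exprD invrM ?unitrX // -!mulrA mulKr ?unitrX.
Qed.

Let conj_G n : N ^+ n * (L^-1 * N ^+ lambda * D n) = G n.
Proof.
have LN : N ^+ n * L^-1 = L^-1 * N ^+ n.
  by apply/commrV/commr_sym/commrX; exact: comm_L0_N.
by rewrite !mulrA LN -(mulrA L^-1) -exprD.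
Qed.

Lemma dual_coefB n :
  N ^+ n * (J + n%:R + a%:M + lambda%:R * N^-1
            + a%:M * L^-1 * N ^+ lambda * D n * A ^t* * (D n)^-1
                * N ^- lambda * L) =
  (J + (n + lambda)%:R * N^-1 + a *: (H n * N ^t* / H n)) * N ^+ n.
Proof.
have aM (X : M) : a%:M * X = a *: X by rewrite -mulmxE mul_scalar_mx.
have aM' (X : M) : X * a%:M = a *: X by rewrite -mulmxE mul_mx_scalar.
have -> : a%:M * L^-1 * N ^+ lambda * D n * A ^t* * (D n)^-1 * N ^- lambda * L =
    a *: (L^-1 * N ^+ lambda * D n * A ^t* * ((G n)^-1 * N ^+ n)).
  by rewrite G_conj -aM !mulrA.
have NV : N ^+ n * N^-1 = N^-1 * N ^+ n.
  exact/commrV/commr_sym/commrX/commr_refl.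
have lE : N ^+ n * (lambda%:R * N^-1) = lambda%:R * N^-1 * N ^+ n.
  by rewrite mulrA (commr_nat _ lambda) -!mulrA NV.
set X := G n * A ^t* / G n.
have -> : H n * N ^t* / H n = 1 + X.
  by rewrite norm_conj trmxC_N mulrDr mulr1 [LHS]mulrDl divrr.
transitivity ((J + n%:R * N^-1) * N ^+ n + a *: N ^+ n
    + lambda%:R * N^-1 * N ^+ n + a *: (X * N ^+ n)).
  rewrite [N ^+ n * _]mulrDr [N ^+ n * _]mulrDr [N ^+ n * _]mulrDr lE aM'.
  rewrite -(@J_conj C m mu n) -scalerAr; congr (_ + _ *: _).
  by rewrite -[L^-1 * _ * _ * _ * _]mulrA [LHS]mulrA conj_G !mulrA.
rewrite natrD !mulrDl scalerDr !mulrDl -!scalerAl mul1r !addrA.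
by congr (_ + _); rewrite addrAC.
Qed.

Lemma dual_coefC n :
  N ^+ n.+1 * (L^-1 * N ^+ lambda * D n.+1 * (D n)^-1 * N ^- lambda * L) =
  H n.+1 * (N^-1) ^t* / H n * N ^+ n.
Proof.
by rewrite norm_ratio -[RHS]mulrA G_conj -conj_G !mulrA.
Qed.

(** Both sides satisfy the same recurrence in n: multiply the recurrence of Pt_n
    at Jfrak(x) by N^n and compare with mulJ_expansion. *)
Lemma dual_polynomials (Pt : nat -> {poly M})
    (Pt_0 : Pt 0%N = 1)
    (Pt_rec : forall n : nat,
       'X * Pt n =
         Pt n.+1
         + (J + n%:R + a%:M + lambda%:R * N^-1
            + a%:M * L^-1 * N ^+ lambda * D n * A ^t* * (D n)^-1
                * N ^- lambda * L)%:P * Pt n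
         + (L^-1 * N ^+ lambda * D n * (D n.-1)^-1
                * N ^- lambda * L)%:P * prev_poly Pt n) n x :
  (P n).[x%:R] = N ^+ n * (Pt n).[Jfrak m mu lambda x].
Proof.
set Jf := Jfrak m mu lambda x.
have CM (c : M) (U : {poly M}) : (c%:P * U).[Jf] = c * U.[Jf].
  by rewrite mul_polyC hornerZ.
have Pt_eval k : (Pt k).[Jf] * Jf = ('X * Pt k).[Jf].
  by rewrite -commr_polyX hornerMX.
suff: (P n).[x%:R] = N ^+ n * (Pt n).[Jf] /\
    (P n.+1).[x%:R] = N ^+ n.+1 * (Pt n.+1).[Jf] by case.
have step k : (P k).[x%:R] = N ^+ k * (Pt k).[Jf] ->
    (prev_poly P k).[x%:R] = N ^+ k.-1 * (prev_poly Pt k).[Jf] ->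
  (P k.+1).[x%:R] = N ^+ k.+1 * (Pt k.+1).[Jf].
  move=> Ek Ek1.
  have Z : N ^+ k * (L^-1 * N ^+ lambda * D k * (D k.-1)^-1 * N ^- lambda * L
        * (prev_poly Pt k).[Jf]) =
      H k * (N^-1) ^t* / H k.-1 * (prev_poly P k).[x%:R].
    case: k Ek Ek1 => [|k] _ Ek1; first by rewrite !horner0 !mulr0.
    rewrite Ek1 [LHS]mulrA [RHS]mulrA.
    exact: (congr1 (fun y => y * _) (dual_coefC k)).
  have := mulJ_expansion a_gt0 mu_gt0 exp_cvg P_orth norm_unit k x.
  rewrite -/Jf {1}Ek -[LHS]mulrA Pt_eval Pt_rec !hornerD !CM [LHS]mulrDr.
  rewrite [N ^+ k * (_ + _)]mulrDr Z.
  rewrite [N ^+ k * (_ * (Pt k).[_])]mulrA dual_coefB.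
  rewrite -[_ * N ^+ k * _]mulrA -Ek.
  move/addIr/addIr/(canLR (mulVKr uN)) => <-.
  by rewrite exprS mulrA.
have step0 : (P 0%N).[x%:R] = N ^+ 0 * (Pt 0%N).[Jf].
  by rewrite (monic_of_degree0 (proj1 P_orth 0%N)) Pt_0 !hornerC mulr1.
elim: n => [|n [IH1 IH2]]; split => //; apply: step => //.
by rewrite /= !horner0 mulr0.
Qed.

End DualRecurrence.

(** * Duality *)

Theorem theorem9p1 (R : realType) (m : nat) (a : R[i]) (mu : nat -> R[i])
    (lambda : nat) (a_gt0 : 0 < a) (mu_cond : mu_condition m a mu)
    (P : nat -> {poly 'M[R[i]]_m.+1})
    (P_orth : monic_orthogonal a mu lambda P)
    (P0_unit : forall n : nat, (P n).[0] \is a GRing.unit)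
    (D : nat -> 'M[R[i]]_m.+1)
    (D_cond : norm_decomposition a mu lambda P D)
    (Q : nat -> {poly 'M[R[i]]_m.+1})
    (Q_cond : Q_condition a mu lambda P Q)
    (A := Amx m mu) (J := Jmx R[i] m) (L := L0 m a mu)
    (Pt : nat -> {poly 'M[R[i]]_m.+1})
    (Pt_0 : Pt 0%N = 1)
    (Pt_rec : forall n : nat,
       'X * Pt n =
         Pt n.+1
         + (J + n%:R + a%:M + lambda%:R * (1 + A)^-1
            + a%:M * L^-1 * (1 + A) ^+ lambda * D n * A ^t* * (D n)^-1
                * (1 + A) ^- lambda * L)%:P * Pt n
         + (L^-1 * (1 + A) ^+ lambda * D n * (D n.-1)^-1
                * (1 + A) ^- lambda * L)%:P * prev_poly Pt n) :
  is_dual Q (rho a mu lambda P) Pt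
    (fun n : nat => (P n).[0]^-1 * (1 + A) ^+ n)
    (fun x : nat => (Upsilon m a mu x)^-1)
    (Jfrak m mu lambda) /\
  (forall n x : nat,
     left_eval (Q x) (rho a mu lambda P n) =
       (P n).[0]^-1 * (1 + A) ^+ n * (Pt n).[Jfrak m mu lambda x]
         * (Upsilon m a mu x)^-1).
Proof.
have duality n x : left_eval (Q x) (rho a mu lambda P n) =
    (P n).[0]^-1 * (1 + A) ^+ n * (Pt n).[Jfrak m mu lambda x]
      * (Upsilon m a mu x)^-1.
  have [_ ->] := Q_cond x; congr (_ * _).
  rewrite -mulrA; congr (_ * _).
  exact: (dual_polynomials a_gt0 (proj1 mu_cond)
    (is_cvg_series_exp_complex a_gt0) P_orth D_cond Pt_0 Pt_rec).
split; last exact: duality.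
split; first by move=> x n; exact: duality.
- by rewrite (monic_of_degree0 (proj1 P_orth 0%N)) hornerC invr1 mulr1.
- by rewrite /Upsilon !expr0 !invr1 scale1r invr1.
exists (fun n => J + n%:R + a%:M + lambda%:R * (1 + A)^-1
          + a%:M * L^-1 * (1 + A) ^+ lambda * D n * A ^t* * (D n)^-1
              * (1 + A) ^- lambda * L).
exists (fun n => L^-1 * (1 + A) ^+ lambda * D n * (D n.-1)^-1
              * (1 + A) ^- lambda * L) => n x.
rewrite -hornerMX commr_polyX Pt_rec !hornerD.
by rewrite 2!mul_polyC 2!hornerZ.
Qed.
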